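(* Let $M$ be an atomic monoid whose set of atoms $H$ admits a stratification $H=H_1\cup\dots\cup H_k$ such that, for each $i\in\{1,\dots,k\}$, the monoid $\langle H_i\cup\dots\cup H_k\rangle$ is inside factorial with base $H_i$. Then each $x\in M$ has a representation of the form $x=h_1+h_2+\dots+h_k$ with (1) $h_i\in\langle H_i\rangle$ for all $i\in\{1,\dots,k\}$, (2) $h_i+\dots+h_k\in\operatorname{Ap}(M,H_1\cup\dots\cup H_{i-1})$ for all $i\in\{2,\dots,k\}$. Moreover, if $M$ is root-closed, then for each $x\in M$ the representation $x=h_1+h_2+\dots+h_k$ with $h_i\in\langle H_i\rangle$ for all $i\in\{1,\dots,k\}$ and $h_i+\dots+h_k\in\operatorname{Ap}(M,H_1\cup\dots\cup H_{i-1})$ for all $i\in\{2,\dots,k\}$ is unique.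
   Context: All monoids are additive, commutative, cancellative and reduced (the only unit is $0$). $\mathbb N$ denotes the nonnegative integers. For $a,b\in M$, $a\le_M b$ means $b=a+c$ for some $c\in M$. An atom of $M$ is a nonzero element that is not a sum of two nonzero elements of $M$; $M$ is atomic if every element is a finite sum of atoms. A monoid is factorial if every element is a sum of atoms in a unique way up to order. $\langle X\rangle$ is the submonoid generated by $X$. For $X\subseteq M$, $\operatorname{Ap}(M,X)=M\setminus(X+M)$. $M$ is root-closed if $na\le_M nb$ with $a,b\in M$ and $n$ a positive integer implies $a\le_M b$. $M$ is inside factorial if there is a factorial submonoid $S\subseteq M$ such that for each $x\in M\setminus\{0\}$ there is a positive integer $m$ with $mx\in S$; the set of atoms of $S$ is then called a base of $M$. A non-empty subset $Q$ of a monoid $M$ is linked to $M$ if for each $x\in M\setminus\{0\}$ there exists $c(x)\in\mathbb N$ such that whenever $\sum_{q\in Q}\lambda_q q\le_M x$ with $\lambda_q\in\mathbb N$ (all but finitely many zero), one has $\sum_{q\in Q}\lambda_q\le c(x)$. A stratification of the set of atoms $H$ of an atomic monoid $M$ is a partition $H=H_1\cup\dots\cup H_k$, $k\ge1$, such that for all $i$ the monoid $\langle H_i\rangle$ is factorial, and the set $H_i$ is linked to the monoid $\langle H_i\cup\dots\cup H_k\rangle$. *)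

(* Defs.v *)
From mathcomp Require Import all_boot all_order all_algebra finmap.
From mathcomp Require Import boolp classical_sets.

Set Implicit Arguments.
Unset Strict Implicit.
Unset Printing Implicit Defensive.

Import GRing.Theory.

Local Open Scope classical_set_scope.
Local Open Scope ring_scope.

(* The ambient commutative monoid is an nmodType V.  Each monoid notion below
   is relative to a submonoid N of V; [set: V] gives the notion for V itself.
   The divisibility order and the atoms depend on N, not only on V. *)

Section Monoids.
Variable V : nmodType.
Implicit Types (N S B Q X : set V) (a b x y : V).

Definition cancellative := forall a x y, a + x = a + y -> x = y.

Definition reduced := forall x y, x + y = 0 -> x = 0.

Definition submonoid N := N 0 /\ (forall x y, N x -> N y -> N (x + y)).

Definition generated X : set V := smallest submonoid X.

Definition divides N a b := exists2 c, N c & b = a + c.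

Definition atoms N : set V :=
  [set a | [/\ N a, a <> 0 &
     forall x y, N x -> N y -> a = x + y -> x = 0 \/ y = 0]].

Definition atom_sum N (s : seq V) x :=
  [set` s] `<=` atoms N /\ x = \sum_(a <- s) a.

Definition atomic N := forall x, N x -> exists s, atom_sum N s x.

Definition factorial N :=
  atomic N /\
  (forall x s t, N x -> atom_sum N s x -> atom_sum N t x -> perm_eq s t).

Definition apery N X : set V := N `\` [set x + y | x in X & y in N].

Definition root_closed N :=
  forall a b (n : nat), N a -> N b -> (0 < n)%N ->
    divides N (a *+ n) (b *+ n) -> divides N a b.

Definition inside_factorial_with_base N B :=
  exists S, [/\ submonoid S, S `<=` N, factorial S,
    (forall x, N x -> x <> 0 -> exists2 m : nat, (0 < m)%N & S (x *+ m)) &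
    atoms S = B].

Definition linked Q N :=
  [/\ Q !=set0, Q `<=` N &
    forall x, N x -> x <> 0 -> exists c : nat,
      forall lam : {fsfun V -> nat with 0%N},
        [set` finsupp lam] `<=` Q ->
        divides N (\sum_(q <- finsupp lam) q *+ lam q) x ->
        (\sum_(q <- finsupp lam) lam q <= c)%N].

(* Blocks are indexed from 0: H i is the (i+1)-st block. *)

Definition blocks_from k (H : 'I_k -> set V) (i : 'I_k) : set V :=
  \bigcup_(j in [set j : 'I_k | (i <= j)%N]) H j.

Definition blocks_before k (H : 'I_k -> set V) (i : 'I_k) : set V :=
  \bigcup_(j in [set j : 'I_k | (j < i)%N]) H j.

Definition stratification N k (H : 'I_k -> set V) :=
  [/\ (0 < k)%N, classical_sets.partition [set: 'I_k] H (atoms N),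
    (forall i, factorial (generated (H i))) &
    (forall i, linked (H i) (generated (blocks_from H i)))].

Definition representation N k (H : 'I_k -> set V) x (h : {ffun 'I_k -> V}) :=
  [/\ x = \sum_(i < k) h i,
    (forall i, generated (H i) (h i)) &
    (forall i : 'I_k, (0 < i)%N ->
       apery N (blocks_before H i) (\sum_(j < k | (i <= j)%N) h j))].

End Monoids.

Arguments cancellative : clear implicits.
Arguments reduced : clear implicits.

(* Main.v *)
Require Import Defs.
From mathcomp Require Import all_boot all_order all_algebra finmap.
From mathcomp Require Import boolp classical_sets.

(** Existence is a greedy division.  Write [N_i] for the monoid generated by
    the blocks from the [i]-th on, and [S_i] for a factorial submonoid of [N_i] with set of atoms [H_i].  An element [x] of
    [N_i] cannot contain arbitrarily many atoms of [H_i]: some positive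
    multiple of [x] lies in [S_i], and its unique factorization there has only
    finitely many factors ([base_length_bounded]).  Hence one may subtract from
    [x] a sum of elements of [H_i] that is as long as possible; the remainder
    then has no atom of [H_i] left ([peel_block]).  Starting from [M] and peeling
    one block after the other, every remainder is divisible by no atom of the
    blocks already treated, so that it is a sum of atoms of the later blocks
    ([apery_generated]) and the process goes on.  After the last block the
    remainder is divisible by no atom at all, hence is [0]
    ([apery_representation]).

    For uniqueness, compare two representations block by block.  Once the
    earlier components are cancelled, what is left is an equation
    [h + r = h' + r'] where [h], [h'] are sums of elements of [H_i], and the
    tails [r], [r'] are divisible by no atom of [H_i].  Some common multiple [n]
    moves both tails into [S_i], and [n h + n r = n h' + n r'] becomes an equation
    between factorizations in [S_i].  If an atom [q] occurred more often in [h]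
    than in [h'], it would occur at least [n] times in [n r'], so [n q] would
    divide [n r']; root-closedness would give that [q] divides [r'], which is
    excluded ([multiplicity_le]).  By symmetry [h = h'], and the tails agree. *)

Set Implicit Arguments.
Unset Strict Implicit.
Unset Printing Implicit Defensive.

Import GRing.Theory.

Local Open Scope classical_set_scope.
Local Open Scope ring_scope.

(** * Submonoids and generators *)

Lemma submonoid_sum (V : nmodType) (N : set V) (I : Type) (r : seq I)
    (P : pred I) (F : I -> V) :
  submonoid N -> (forall i, P i -> N (F i)) -> N (\sum_(i <- r | P i) F i).
Proof. by move=> [N0 ND] NF; elim/big_rec: _ => // i x Pi; apply/ND/NF. Qed.

Lemma submonoid_sum_seq (V : nmodType) (N : set V) (s : seq V) :
  submonoid N -> [set` s] `<=` N -> N (\sum_(a <- s) a).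
Proof. by move=> subN sN; rewrite big_seq; apply: submonoid_sum. Qed.

Lemma submonoid_mulrn (V : nmodType) (N : set V) x n :
  submonoid N -> N x -> N (x *+ n).
Proof.
by move=> [N0 ND] Nx; elim: n => [|n IHn]; rewrite ?mulr0n // mulrS; apply: ND.
Qed.

Lemma submonoid_generated (V : nmodType) (X : set V) :
  submonoid (generated X).
Proof.
split=> [A [[]]//|x y Xx Xy A AX].
by case: (AX) => [[_ AD] _]; apply: AD; [apply: Xx | apply: Xy].
Qed.

Lemma sub_generated (V : nmodType) (X Y : set V) :
  X `<=` Y -> generated X `<=` generated Y.
Proof.
by move=> XY x Xx A [subA YA]; apply: Xx; split=> //; apply: subset_trans YA.
Qed.

Lemma generatedP (V : nmodType) (X : set V) x :
  generated X x <-> exists2 s : seq V, [set` s] `<=` X & x = \sum_(a <- s) a.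
Proof.
split=> [|[s sX ->]].
  pose Y := [set x | exists2 s : seq V, [set` s] `<=` X & x = \sum_(a <- s) a].
  move: x; apply: (@smallest_sub _ (@submonoid V) X Y) => [|y Xy]; last first.
    by exists [:: y]; rewrite ?big_seq1 // => z /=; rewrite inE => /eqP ->.
  split=> [|y z [s sX ->] [t tX ->]]; first by exists [::]; rewrite ?big_nil.
  exists (s ++ t); last by rewrite big_cat.
  by move=> a /=; rewrite mem_cat => /orP[/sX | /tX].
apply: submonoid_sum_seq; first exact: submonoid_generated.
by apply: (subset_trans sX); apply: sub_gen_smallest.
Qed.

(** * Multiples of factorizations *)

Definition copies (T : Type) n (s : seq T) := flatten (nseq n s).

Lemma count_copies (T : Type) (a : pred T) n s :
  count a (copies n s) = (n * count a s)%N.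
Proof. by rewrite count_flatten map_nseq sumn_nseq mulnC. Qed.

Lemma size_copies (T : Type) n (s : seq T) :
  size (copies n s) = (n * size s)%N.
Proof. by rewrite -!count_predT count_copies. Qed.

Lemma sum_copies (V : nmodType) n (s : seq V) :
  \sum_(a <- copies n s) a = (\sum_(a <- s) a) *+ n.
Proof.
rewrite /copies; elim: n => [|n IHn]; first by rewrite mulr0n big_nil.
by rewrite /= big_cat /= IHn mulrS.
Qed.

Lemma sub_copies (T : eqType) (X : set T) n s :
  [set` s] `<=` X -> [set` copies n s] `<=` X.
Proof.
by move=> sX x /flattenP[t /nseqP[-> _]]; apply: sX.
Qed.

Lemma sub_cat (T : eqType) (X : set T) (s t : seq T) :
  [set` s] `<=` X -> [set` t] `<=` X -> [set` s ++ t] `<=` X.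
Proof. by move=> sX tX x /=; rewrite mem_cat => /orP[/sX | /tX]. Qed.

Lemma factorial_perm_eq (V : nmodType) (S : set V) (s t : seq V) :
  submonoid S -> Defs.factorial S -> [set` s] `<=` atoms S -> [set` t] `<=` atoms S ->
  \sum_(a <- s) a = \sum_(a <- t) a -> perm_eq s t.
Proof.
move=> subS [_ factS] sS tS eq_st; apply: factS (conj sS erefl) (conj tS eq_st).
by apply: submonoid_sum_seq => // a /sS[].
Qed.

(** * Inside factorial monoids *)

Lemma inside_factorial_multiple (V : nmodType) (N S : set V) x :
  submonoid S ->
  (forall x, N x -> x <> 0 -> exists2 m : nat, (0 < m)%N & S (x *+ m)) ->
  N x -> exists2 m : nat, (0 < m)%N & S (x *+ m).
Proof.
move=> [S0 _] multS Nx; have [->|/eqP xN0] := eqVneq x 0; last exact: multS.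
by exists 1%N; rewrite ?mulr1n.
Qed.

(** If [x *+ m] has [L] factors in [S] and [x] is [s] plus a remainder [y], then,
    after a further multiplication by some [p] with [y *+ p] in [S], the [m * p]
    copies of [s] are part of the [p * L] factors of [x *+ (m * p)]; hence
    [size s <= L]. *)
Lemma base_length_bounded (V : nmodType) (N B : set V) x :
  inside_factorial_with_base N B -> N x ->
  exists c : nat, forall (s : seq V) y, [set` s] `<=` B -> N y ->
    x = \sum_(a <- s) a + y -> (size s <= c)%N.
Proof.
move=> [S [subS SN factS multS <-]] Nx.
have [m m_gt0 Sxm] := inside_factorial_multiple subS multS Nx.
have [u [uS xm_u]] := factS.1 _ Sxm.
exists (size u) => s y sS Ny x_sy.
have [p p_gt0 Syp] := inside_factorial_multiple subS multS Ny.
have [v [vS yp_v]] := factS.1 _ Syp.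
have /perm_size : perm_eq (copies p u) (copies (m * p) s ++ copies m v).
  apply: factorial_perm_eq subS factS _ _ _; first exact: sub_copies.
    by apply: sub_cat; apply: sub_copies.
  by rewrite big_cat /= !sum_copies -xm_u -yp_v -!mulrnA (mulnC p) -mulrnDl -x_sy.
rewrite size_cat !size_copies => sz.
have: (p * size s <= p * size u)%N.
  by rewrite sz; apply: leq_trans (leq_addr _ _); rewrite -mulnA leq_pmull.
by rewrite leq_pmul2l.
Qed.

(** The remainder left by a longest subtractable sum is not divisible by any
    element of the base, since otherwise the sum could be lengthened. *)
Lemma base_division (V : nmodType) (N B : set V) x :
  submonoid N -> inside_factorial_with_base N B -> N x ->
  exists h y, [/\ x = h + y, generated B h & apery N B y].
Proof.
move=> subN base Nx; have [c bound] := base_length_bounded base Nx.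
pose P n := `[< exists (s : seq V) y,
  [/\ size s = n, [set` s] `<=` B, N y & x = \sum_(a <- s) a + y] >].
have exP : exists n, P n.
  by exists 0%N; apply/asboolP; exists [::], x; rewrite big_nil add0r.
have ubP n : P n -> (n <= c)%N.
  by move=> /asboolP[s [y [<- sB Ny /bound]]]; apply.
have [n /asboolP[s [y [<- sB Ny x_sy]]] max_s] := ex_maxnP exP ubP.
exists (\sum_(a <- s) a), y; split=> //; first by apply/generatedP; exists s.
split=> // -[q Bq [z Nz qz_y]].
suff /max_s : P (size s).+1 by rewrite ltnn.
apply/asboolP; exists (q :: s), z; split=> //.
  by move=> a /=; rewrite inE => /orP[/eqP-> // | /sB].
by rewrite x_sy -qz_y big_cons addrCA addrA.
Qed.

(** Comparison of multiplicities.  Multiplied by a suitable [n], the equation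
    takes place in [S], where an excess of [q] in [s] over [t] becomes an excess
    of at least [n], which only the factors of [r' *+ n] can compensate. *)
Lemma multiplicity_le (M : nmodType) (N B : set M) (s t : seq M) r r' q :
  root_closed [set: M] -> inside_factorial_with_base N B ->
  [set` s] `<=` B -> [set` t] `<=` B -> N r -> N r' ->
  \sum_(a <- s) a + r = \sum_(a <- t) a + r' ->
  (forall q, B q -> ~ divides [set: M] q r') ->
  (count_mem q s <= count_mem q t)%N.
Proof.
move=> rootM [S [subS SN factS multS <-]] sS tS Nr Nr' eq_st no_div.
rewrite leqNgt; apply/negP => lt_ts.
have Sq : atoms S q.
  by apply: sS; rewrite /= -has_pred1 has_count; apply: leq_ltn_trans lt_ts.
have [m m_gt0 Srm] := inside_factorial_multiple subS multS Nr.
have [p p_gt0 Srp] := inside_factorial_multiple subS multS Nr'.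
pose n := (m * p)%N.
have Srn : S (r *+ n) by rewrite mulrnA; apply: submonoid_mulrn.
have Srn' : S (r' *+ n) by rewrite /n mulnC mulrnA; apply: submonoid_mulrn.
have [u [uS rn_u]] := factS.1 _ Srn.
have [v [vS rn_v]] := factS.1 _ Srn'.
have /permP/(_ (pred1 q)) : perm_eq (copies n s ++ u) (copies n t ++ v).
  apply: factorial_perm_eq subS factS _ _ _;
    try by apply: sub_cat => //; apply: sub_copies.
  by rewrite !big_cat /= !sum_copies -rn_u -rn_v -!mulrnDl eq_st.
rewrite !count_cat !count_copies => eq_count.
have le_nv : (n <= count_mem q v)%N.
  rewrite -(leq_add2l (n * count_mem q t)) -eq_count -mulnSr.
  by apply: leq_trans (leq_addr _ _); rewrite leq_mul2l lt_ts orbT.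
apply: (no_div q Sq); apply: (rootM _ _ n) => //; first by rewrite muln_gt0 m_gt0.
exists (q *+ (count_mem q v - n) + \sum_(a <- v | a != q) a) => //.
rewrite addrA -mulrnDr subnKC // rn_v (bigID (pred1 q)) /=; congr (_ + _).
by rewrite (eq_bigr (fun=> q)) => [|a /eqP//]; rewrite big_const_seq iter_addr_0.
Qed.

(** * Peeling off the blocks *)

(** Indexing by a natural number rather than an ordinal allows [m = k], where
    these are all the blocks. *)
Definition first_blocks (V : nmodType) k (H : 'I_k -> set V) (m : nat) :
  set V := \bigcup_(j in [set j : 'I_k | (j < m)%N]) H j.

Lemma apery_summand (M : nmodType) (X : set M) a y :
  apery [set: M] X (a + y) -> apery [set: M] X y.
Proof.
move=> [_ noX]; split=> // -[q Xq [z _ qz_y]]; apply: noX.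
by exists q => //; exists (a + z); rewrite // addrCA qz_y.
Qed.

Lemma apery_atom_sum (M : nmodType) (X : set M) (s : seq M) a :
  apery [set: M] X (\sum_(a <- s) a) -> a \in s -> ~ X a.
Proof.
move=> [_ noX] sa Xa; apply: noX.
exists a => //; exists (\sum_(b <- rem a s) b) => //.
by rewrite (perm_big _ (perm_to_rem sa)) /= big_cons.
Qed.

Lemma apery_generated (M : nmodType) k (H : 'I_k -> set M) (i : 'I_k) x :
  atomic [set: M] -> atoms [set: M] `<=` \bigcup_j H j ->
  apery [set: M] (blocks_before H i) x -> generated (blocks_from H i) x.
Proof.
move=> atomicM atomH; have [s [s_atom ->]] := atomicM x I.
move=> apx; apply/generatedP; exists s => // a sa.
have [j _ Hja] := atomH a (s_atom a sa).
exists j => //=; rewrite leqNgt; apply/negP => lt_ji.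
by apply: (apery_atom_sum apx sa); exists j.
Qed.

(** Base division in [generated (blocks_from H i)] gives a remainder without
    atoms of [H i] relative to that submonoid.  This persists in [M]: a cofactor
    [z] in [M] of an atom of [H i] inherits from [x] the absence of earlier
    atoms, hence already lies in the submonoid. *)
Lemma peel_block (M : nmodType) k (H : 'I_k -> set M) (i : 'I_k) x :
  atomic [set: M] -> atoms [set: M] `<=` \bigcup_j H j ->
  inside_factorial_with_base (generated (blocks_from H i)) (H i) ->
  apery [set: M] (first_blocks H i) x ->
  exists h y, [/\ x = h + y, generated (H i) h &
                 apery [set: M] (first_blocks H i.+1) y].
Proof.
move=> atomicM atomH base apx.
have Nx := apery_generated atomicM atomH apx.
have [h [y [x_hy Hh [_ no_div]]]] :=
  base_division (submonoid_generated _) base Nx.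
exists h, y; split=> //.
have apy : apery [set: M] (first_blocks H i) y.
  by apply: (@apery_summand _ _ h); rewrite -x_hy.
split=> // -[q [j /= le_ji Hjq] [z _ qz_y]].
move: le_ji; rewrite ltnS leq_eqVlt => /orP[/eqP/val_inj eq_ji|lt_ji].
  apply: no_div; exists q; first by rewrite -eq_ji.
  exists z => //; apply: apery_generated => //.
  by apply: (@apery_summand _ _ q); rewrite qz_y.
by apply: apy.2; exists q; [exists j | exists z].
Qed.

Lemma tail_sum (V : nmodType) k (h : 'I_k -> V) (i : 'I_k) :
  \sum_(j < k | (i <= j)%N) h j = h i + \sum_(j < k | (i < j)%N) h j.
Proof.
rewrite (bigD1 i) //=; congr (_ + _); apply: eq_bigl => j.
by rewrite ltn_neqAle andbC eq_sym.
Qed.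

Lemma apery_representation (M : nmodType) k (H : 'I_k -> set M) m x :
  atomic [set: M] -> atoms [set: M] `<=` \bigcup_j H j ->
  (forall i : 'I_k,
     inside_factorial_with_base (generated (blocks_from H i)) (H i)) ->
  (m <= k)%N -> apery [set: M] (first_blocks H m) x ->
  exists h : {ffun 'I_k -> M},
    [/\ x = \sum_(j < k | (m <= j)%N) h j,
       forall i, generated (H i) (h i) &
       forall i : 'I_k, (m <= i)%N ->
         apery [set: M] (blocks_before H i) (\sum_(j < k | (i <= j)%N) h j)].
Proof.
move=> atomicM atomH base le_mk.
have [d le_dk -> {m le_mk}] : exists2 d, (d <= k)%N & m = (k - d)%N.
  by exists (k - m)%N; rewrite ?leq_subr ?subKn.
elim: d le_dk x => [|d IHd] le_dk x.
  rewrite subn0 => apx; exists [ffun => 0]; split=> [|i|i]; last first.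
  - by rewrite leqNgt ltn_ord.
  - by rewrite ffunE; case: (submonoid_generated (H i)).
  rewrite big_pred0 => [|j]; last by rewrite leqNgt ltn_ord.
  (* All atoms of [M] are now excluded from the factorization of [x]. *)
  have [s [s_atom x_s]] := atomicM x I; rewrite x_s in apx *.
  case: s s_atom apx {x_s} => [|a s] s_atom apx; first by rewrite big_nil.
  have as_a : a \in a :: s by rewrite inE eqxx.
  have [j _ Hja] := atomH a (s_atom a as_a).
  by case: (apery_atom_sum apx as_a); exists j => /=.
have lt_mk : (k - d.+1 < k)%N by rewrite ltn_subrL (leq_trans _ le_dk).
have Sm : (k - d.+1).+1 = (k - d)%N by rewrite subnSK.
pose i0 := Ordinal lt_mk; move=> apx.
have [h0 [y [x_hy Hh0 apy]]] := peel_block atomicM atomH (base i0) apx.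
have [|g [y_g Hg apg]] := IHd (ltnW le_dk) y; first by rewrite -Sm.
pose h := [ffun j => if j == i0 then h0 else g j].
have tail_h m : (k - d.+1 < m)%N ->
    \sum_(j < k | (m <= j)%N) h j = \sum_(j < k | (m <= j)%N) g j.
  move=> lt_m; apply: eq_bigr => j le_mj; rewrite ffunE; case: eqP => // j_i0.
  by move: le_mj; rewrite j_i0 leqNgt lt_m.
have x_h : x = \sum_(j < k | (k - d.+1 <= j)%N) h j.
  by rewrite (tail_sum h i0) /= tail_h // ffunE eqxx Sm -y_g.
exists h; split=> // [i|i]; first by rewrite ffunE; case: eqP => [->|].
rewrite leq_eqVlt => /orP[/eqP i0_i|lt_i0i].
  by rewrite -i0_i -x_h /blocks_before -i0_i.
by rewrite tail_h //; apply: apg; rewrite -Sm.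
Qed.

(** * Uniqueness *)

(** After the last block the tail is [0], and reducedness replaces the Apery
    condition. *)
Lemma tail_not_divisible (M : nmodType) k (H : 'I_k -> set M)
    (h : {ffun 'I_k -> M}) x (i : 'I_k) q :
  reduced M -> H i `<=` atoms [set: M] -> representation [set: M] H x h ->
  H i q -> ~ divides [set: M] q (\sum_(j < k | (i < j)%N) h j).
Proof.
move=> redM Hatom [_ _ aph] Hiq [z _].
have [lt_ik|le_ki] := ltnP i.+1 k.
  have [_ no_div] := aph (Ordinal lt_ik) isT.
  by move=> tail_qz; apply: no_div; exists q; [exists i => /= | exists z].
rewrite big_pred0 => [/esym/redM q0 | j].
  by have [_] := Hatom q Hiq; rewrite q0.
by apply/negbTE; rewrite -leqNgt -ltnS (leq_trans (ltn_ord j)).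
Qed.

Lemma representation_block_eq (M : nmodType) k (H : 'I_k -> set M)
    (h h' : {ffun 'I_k -> M}) x x' (i : 'I_k) :
  reduced M -> root_closed [set: M] -> H i `<=` atoms [set: M] ->
  inside_factorial_with_base (generated (blocks_from H i)) (H i) ->
  representation [set: M] H x h -> representation [set: M] H x' h' ->
  \sum_(j < k | (i <= j)%N) h j = \sum_(j < k | (i <= j)%N) h' j ->
  h i = h' i.
Proof.
move=> redM rootM Hatom base rep_h rep_h'; rewrite !tail_sum.
have tail_N y f : representation [set: M] H y f ->
    generated (blocks_from H i) (\sum_(j < k | (i < j)%N) f j).
  move=> [_ Hf _]; apply: submonoid_sum => [|j lt_ij].
    exact: submonoid_generated.
  by apply: (sub_generated _ (Hf j)) => a Hja; exists j => //=; apply: ltnW.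
have [_ /(_ i)/generatedP[s sH h_s] _] := rep_h.
have [_ /(_ i)/generatedP[t tH h'_t] _] := rep_h'.
rewrite h_s h'_t => eq_st; apply: perm_big; apply/allP => q _ /=.
rewrite eqn_leq; apply/andP; split.
  apply: multiplicity_le rootM base sH tH (tail_N _ _ rep_h) (tail_N _ _ rep_h')
    eq_st _ => p.
  exact: tail_not_divisible rep_h'.
apply: multiplicity_le rootM base tH sH (tail_N _ _ rep_h') (tail_N _ _ rep_h)
  (esym eq_st) _ => p.
exact: tail_not_divisible rep_h.
Qed.

Lemma representation_unique (M : nmodType) k (H : 'I_k -> set M)
    (h h' : {ffun 'I_k -> M}) x :
  cancellative M -> reduced M -> root_closed [set: M] ->
  (forall i, H i `<=` atoms [set: M]) ->
  (forall i : 'I_k,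
     inside_factorial_with_base (generated (blocks_from H i)) (H i)) ->
  representation [set: M] H x h -> representation [set: M] H x h' -> h = h'.
Proof.
move=> canM redM rootM Hatom base rep_h rep_h'; apply/ffunP => i.
have [n le_in] := ubnP i; elim: n i le_in => // n IHn i le_in.
apply: (representation_block_eq _ _ _ _ rep_h rep_h') => //.
have [x_h _ _] := rep_h; have [x_h' _ _] := rep_h'.
have split_sum (f : 'I_k -> M) : \sum_(j < k) f j =
    \sum_(j < k | (j < i)%N) f j + \sum_(j < k | (i <= j)%N) f j.
  rewrite (bigID (fun j : 'I_k => (j < i)%N)) /=; congr (_ + _).
  by apply: eq_bigl => j; rewrite -leqNgt.
apply: (canM (\sum_(j < k | (j < i)%N) h j)); rewrite -split_sum -x_h.
rewrite {1}x_h' split_sum; congr (_ + _); apply: eq_bigr => j lt_ji.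
by rewrite IHn // (leq_trans lt_ji).
Qed.

Theorem theorem29 (M : nmodType) (k : nat) (H : 'I_k -> set M)
    (M_cancellative : cancellative M) (M_reduced : reduced M)
    (M_atomic : atomic [set: M])
    (H_stratification : stratification [set: M] H)
    (H_base : forall i : 'I_k,
       inside_factorial_with_base (generated (blocks_from H i)) (H i)) :
  (forall x : M, exists h : {ffun 'I_k -> M}, representation [set: M] H x h) /\
  (root_closed [set: M] ->
   forall x : M, exists! h : {ffun 'I_k -> M}, representation [set: M] H x h).
Proof.
have [_ [coverH _ _] _ _] := H_stratification.
have Hatom i : H i `<=` atoms [set: M] by rewrite -coverH => a Ha; exists i.
have ex_rep x : exists h : {ffun 'I_k -> M}, representation [set: M] H x h.
  have [||h [x_h Hh aph]] := @apery_representation M k H 0 x M_atomic _ H_base isT.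
  - by rewrite -coverH.
  - by split=> // -[q [j]].
  by exists h; split=> // i _; apply: aph.
split=> // rootM x; have [h rep_h] := ex_rep x.
exists h; split=> // h'.
exact: (representation_unique M_cancellative M_reduced rootM Hatom H_base rep_h).
Qed.
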